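(* Let $F:\mathcal{A}\to \mathcal{B}$ be a fully faithful covariant functor between abelian categories, and let $M$ and $N$ be objects of $\mathcal{A}$. (1) Assume that $F$ is left exact. Then $N$ is $M$-Rickart in $\mathcal{A}$ if and only if $F(N)$ is $F(M)$-Rickart in $\mathcal{B}$. (2) Assume that $F$ is right exact. Then $N$ is dual $M$-Rickart in $\mathcal{A}$ if and only if $F(N)$ is dual $F(M)$-Rickart in $\mathcal{B}$.
   Context: A section is a split monomorphism and a retraction is a split epimorphism. For objects $M,N$ of an abelian category, $N$ is called $M$-Rickart if for every morphism $f:M\to N$ the kernel $\ker(f):\mathrm{Ker}(f)\to M$ is a section (equivalently, $\mathrm{Ker}(f)$ is a direct summand of $M$); $N$ is called dual $M$-Rickart if for every morphism $f:M\to N$ the cokernel $N\to\mathrm{Coker}(f)$ is a retraction (equivalently, $\mathrm{Im}(f)$ is a direct summand of $N$). *)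

(* Defs.v *)
From HB Require Import structures.
From mathcomp Require Import all_boot ssralg.

Set Implicit Arguments.
Unset Strict Implicit.
Unset Printing Implicit Defensive.

Import GRing.Theory.
Local Open Scope ring_scope.

(* Composition is written in the usual order: compm g f is "g after f". *)
HB.mixin Record isCategory (obj : Type) := {
  mor : obj -> obj -> Type;
  idm : forall a : obj, mor a a;
  compm : forall a b c : obj, mor b c -> mor a b -> mor a c;
  comp1m : forall (a b : obj) (f : mor a b), compm a b b (idm b) f = f;
  compm1 : forall (a b : obj) (f : mor a b), compm a a b f (idm a) = f;
  compmA : forall (a b c d : obj) (h : mor c d) (g : mor b c) (f : mor a b),
    compm a c d h (compm a b c g f) = compm a b d (compm b c d h g) f
}.

#[short(type="categoryType")]
HB.structure Definition Category := { obj of isCategory obj }.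

Arguments idm {_} _.
Arguments compm {_ _ _ _} _ _.
Notation "g \oc f" := (compm g f) (at level 40, left associativity).

HB.mixin Record hasMorGroups obj of Category obj := {
  mor_zmod : forall a b : obj, GRing.Zmodule (mor a b)
}.

HB.structure Definition MorGroups := { obj of Category obj & hasMorGroups obj }.

HB.instance Definition _ (C : MorGroups.type) (a b : C) : GRing.Zmodule (mor a b) :=
  mor_zmod a b.

HB.mixin Record isPreadditive obj of MorGroups obj := {
  compmDl : forall (a b c : obj) (g1 g2 : mor b c) (f : mor a b),
    (g1 + g2) \oc f = g1 \oc f + g2 \oc f;
  compmDr : forall (a b c : obj) (g : mor b c) (f1 f2 : mor a b),
    g \oc (f1 + f2) = g \oc f1 + g \oc f2
}.

#[short(type="preadditiveType")]
HB.structure Definition Preadditive := { obj of MorGroups obj & isPreadditive obj }.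

Section CategoryNotions.
Variable C : categoryType.

Definition monomorphism (a b : C) (f : mor a b) : Prop :=
  forall (x : C) (u v : mor x a), f \oc u = f \oc v -> u = v.

Definition epimorphism (a b : C) (f : mor a b) : Prop :=
  forall (x : C) (u v : mor b x), u \oc f = v \oc f -> u = v.

Definition is_section (a b : C) (f : mor a b) : Prop :=
  exists r : mor b a, r \oc f = idm a.

Definition is_retraction (a b : C) (f : mor a b) : Prop :=
  exists s : mor b a, f \oc s = idm b.

Definition zero_object (z : C) : Prop :=
  forall a : C, (exists! f : mor z a, True) /\ (exists! f : mor a z, True).

End CategoryNotions.

Section PreadditiveNotions.
Variable C : preadditiveType.

Definition is_kernel (a b : C) (f : mor a b) (k : C) (i : mor k a) : Prop :=
  f \oc i = 0 /\
  forall (x : C) (u : mor x a), f \oc u = 0 -> exists! v : mor x k, i \oc v = u.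

Definition is_cokernel (a b : C) (f : mor a b) (q : C) (p : mor b q) : Prop :=
  p \oc f = 0 /\
  forall (x : C) (u : mor b x), u \oc f = 0 -> exists! v : mor q x, v \oc p = u.

Definition is_biproduct (a b s : C)
    (i1 : mor a s) (i2 : mor b s) (p1 : mor s a) (p2 : mor s b) : Prop :=
  [/\ p1 \oc i1 = idm a, p2 \oc i2 = idm b, p1 \oc i2 = 0, p2 \oc i1 = 0
    & i1 \oc p1 + i2 \oc p2 = idm s].

Definition is_image (a b : C) (f : mor a b) (m : C) (i : mor m b) : Prop :=
  exists (q : C) (p : mor b q), is_cokernel f p /\ is_kernel p i.

(* Im f = Ker g as subobjects of b *)
Definition exact_at (a b c : C) (f : mor a b) (g : mor b c) : Prop :=
  exists (m : C) (i : mor m b), is_image f i /\ is_kernel g i.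

(* 0 -> a -> b -> c *)
Definition left_exact_seq (a b c : C) (f : mor a b) (g : mor b c) : Prop :=
  exists z : C,
    [/\ zero_object z, exact_at (0 : mor z a) f & exact_at f g].

(* a -> b -> c -> 0 *)
Definition right_exact_seq (a b c : C) (f : mor a b) (g : mor b c) : Prop :=
  exists z : C,
    [/\ zero_object z, exact_at f g & exact_at g (0 : mor c z)].

End PreadditiveNotions.

HB.mixin Record isAbelian obj of Preadditive obj := {
  has_zero_object : exists z : obj, zero_object z;
  has_biproducts : forall a b : obj,
    exists (s : obj) (i1 : mor a s) (i2 : mor b s) (p1 : mor s a) (p2 : mor s b),
      is_biproduct i1 i2 p1 p2;
  has_kernels : forall (a b : obj) (f : mor a b),
    exists (k : obj) (i : mor k a), is_kernel f i;
  has_cokernels : forall (a b : obj) (f : mor a b),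
    exists (q : obj) (p : mor b q), is_cokernel f p;
  monic_normal : forall (a b : obj) (f : mor a b), monomorphism f ->
    exists (c : obj) (g : mor b c), is_kernel g f;
  epic_normal : forall (a b : obj) (f : mor a b), epimorphism f ->
    exists (c : obj) (g : mor c a), is_cokernel g f
}.

#[short(type="abelianType")]
HB.structure Definition Abelian := { obj of Preadditive obj & isAbelian obj }.

Record functor (C D : categoryType) := Functor {
  fobj :> C -> D;
  fmap : forall a b : C, mor a b -> mor (fobj a) (fobj b);
  fmap1 : forall a : C, fmap (idm a) = idm (fobj a);
  fmap_comp : forall (a b c : C) (g : mor b c) (f : mor a b),
    fmap (g \oc f) = fmap g \oc fmap f
}.

Section FunctorNotions.
Variables C D : categoryType.

Definition faithful (F : functor C D) : Prop :=
  forall a b : C, injective (@fmap C D F a b).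

Definition full (F : functor C D) : Prop :=
  forall (a b : C) (g : mor (F a) (F b)), exists f : mor a b, fmap F f = g.

Definition fully_faithful (F : functor C D) : Prop := full F /\ faithful F.

End FunctorNotions.

Section Exactness.
Variables A B : abelianType.

(* Additivity is not required separately: a functor between abelian categories
   preserving these sequences preserves zero objects and (split) biproduct
   sequences, hence is additive. *)
Definition left_exact (F : functor A B) : Prop :=
  forall (a b c : A) (f : mor a b) (g : mor b c),
    left_exact_seq f g -> left_exact_seq (fmap F f) (fmap F g).

Definition right_exact (F : functor A B) : Prop :=
  forall (a b c : A) (f : mor a b) (g : mor b c),
    right_exact_seq f g -> right_exact_seq (fmap F f) (fmap F g).

End Exactness.

Section Rickart.
Variable A : abelianType.

(* Kernels and cokernels are determined up to isomorphism only, so the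
   conditions range over all of them. *)
Definition Rickart (M N : A) : Prop :=
  forall (f : mor M N) (K : A) (k : mor K M), is_kernel f k -> is_section k.

Definition dual_Rickart (M N : A) : Prop :=
  forall (f : mor M N) (Q : A) (q : mor N Q), is_cokernel f q -> is_retraction q.

End Rickart.

(* Main.v *)
Require Import Defs.
From HB Require Import structures.
From mathcomp Require Import all_boot ssralg.

Set Implicit Arguments.
Unset Strict Implicit.
Unset Printing Implicit Defensive.

(** A left exact functor preserves kernels, because in an abelian category
    [i] is a kernel of [g] exactly when [0 -> k -> a -> b], with arrows [i] and
    [g], is left exact ([left_exact_seqP]).  A fully faithful functor preserves
    and reflects sections, since it lifts one-sided inverses uniquely
    ([section_fmapP]).  Hence, for [f : M -> N] with kernel [k], the arrow [F k]
    is a kernel of [F f], and [k] is a section iff [F k] is.  By fullness every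
    arrow [F M -> F N] is some [F f], and any two kernels of the same arrow are
    isomorphic, so being a section does not depend on the kernel chosen
    ([section_kernel]); this makes the two Rickart conditions equivalent.
    Part (2) is the dual argument with cokernels and retractions. *)

Import GRing.Theory.
Local Open Scope ring_scope.

(** * Zero morphisms, kernels and cokernels *)

Section Preadditive.
Variable C : preadditiveType.

Lemma compm0 (a b c : C) (g : mor b c) : g \oc (0 : mor a b) = 0.
Proof. by apply: (addIr (g \oc 0)); rewrite -compmDr !add0r. Qed.

Lemma comp0m (a b c : C) (f : mor a b) : (0 : mor b c) \oc f = 0.
Proof. by apply: (addIr (0 \oc f)); rewrite -compmDl !add0r. Qed.

Lemma monomorphism0 (a b : C) (f : mor a b) :
  (forall (x : C) (u : mor x a), f \oc u = 0 -> u = 0) -> monomorphism f.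
Proof.
move=> f_inj x u v fuv; apply: (addIr (- v)); rewrite subrr; apply: f_inj.
by rewrite compmDr fuv -compmDr subrr compm0.
Qed.

Lemma epimorphism0 (a b : C) (f : mor a b) :
  (forall (x : C) (u : mor b x), u \oc f = 0 -> u = 0) -> epimorphism f.
Proof.
move=> f_inj x u v ufv; apply: (addIr (- v)); rewrite subrr; apply: f_inj.
by rewrite compmDl ufv -compmDl subrr comp0m.
Qed.

Lemma zero_object_from (z a : C) (u : mor z a) : zero_object z -> u = 0.
Proof. by case/(_ a) => -[w [_ w_uniq]] _; rewrite -(w_uniq u I) (w_uniq 0 I). Qed.

Lemma zero_object_to (z a : C) (u : mor a z) : zero_object z -> u = 0.
Proof. by case/(_ a) => _ [w [_ w_uniq]]; rewrite -(w_uniq u I) (w_uniq 0 I). Qed.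

Lemma kernel_mono (a b k : C) (f : mor a b) (i : mor k a) :
  is_kernel f i -> monomorphism i.
Proof.
case=> fi0 i_univ x u v iuv.
have [|w [_ w_uniq]] := i_univ x (i \oc u).
  by rewrite compmA fi0 comp0m.
by rewrite -(w_uniq u) // (w_uniq v).
Qed.

Lemma cokernel_epi (a b q : C) (f : mor a b) (p : mor b q) :
  is_cokernel f p -> epimorphism p.
Proof.
case=> pf0 p_univ x u v upv.
have [|w [_ w_uniq]] := p_univ x (u \oc p).
  by rewrite -compmA pf0 compm0.
by rewrite -(w_uniq u) // (w_uniq v).
Qed.

Lemma kernel_factor (a b k x : C) (f : mor a b) (i : mor k a) (u : mor x a) :
  is_kernel f i -> f \oc u = 0 -> exists v, i \oc v = u.
Proof. by case=> _ i_univ /i_univ[v [iv _]]; exists v. Qed.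

Lemma cokernel_factor (a b q x : C) (f : mor a b) (p : mor b q) (u : mor b x) :
  is_cokernel f p -> u \oc f = 0 -> exists v, v \oc p = u.
Proof. by case=> _ p_univ /p_univ[v [vp _]]; exists v. Qed.

Lemma mono_kernel (a b k : C) (f : mor a b) (i : mor k a) :
  monomorphism i -> f \oc i = 0 ->
  (forall (x : C) (u : mor x a), f \oc u = 0 -> exists v, i \oc v = u) ->
  is_kernel f i.
Proof.
move=> i_mono fi0 i_fac; split=> // x u /i_fac[v iv].
by exists v; split=> // w iw; apply: i_mono; rewrite iv iw.
Qed.

Lemma epi_cokernel (a b q : C) (f : mor a b) (p : mor b q) :
  epimorphism p -> p \oc f = 0 ->
  (forall (x : C) (u : mor b x), u \oc f = 0 -> exists v, v \oc p = u) ->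
  is_cokernel f p.
Proof.
move=> p_epi pf0 p_fac; split=> // x u /p_fac[v vp].
by exists v; split=> // w wp; apply: p_epi; rewrite vp wp.
Qed.

Lemma kernel0 (z a b : C) (f : mor a b) :
  zero_object z -> monomorphism f -> is_kernel f (0 : mor z a).
Proof.
move=> z0 f_mono; apply: mono_kernel => [x u v _||x u fu0].
- by rewrite (zero_object_to u z0) (zero_object_to v z0).
- by rewrite compm0.
- by exists 0; apply: f_mono; rewrite compm0 compm0 fu0.
Qed.

Lemma cokernel0 (z a b : C) (f : mor a b) :
  zero_object z -> epimorphism f -> is_cokernel f (0 : mor b z).
Proof.
move=> z0 f_epi; apply: epi_cokernel => [x u v _||x u uf0].
- by rewrite (zero_object_from u z0) (zero_object_from v z0).
- by rewrite comp0m.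
- by exists 0; apply: f_epi; rewrite comp0m comp0m uf0.
Qed.

Lemma idm_mono (a : C) : monomorphism (idm a).
Proof. by move=> x u v; rewrite !comp1m. Qed.

Lemma idm_epi (a : C) : epimorphism (idm a).
Proof. by move=> x u v; rewrite !compm1. Qed.

Lemma idm_kernel (a b : C) : is_kernel (0 : mor a b) (idm a).
Proof.
apply: mono_kernel => [||x u _]; first exact: idm_mono.
- by rewrite compm1.
- by exists u; rewrite comp1m.
Qed.

Lemma idm_cokernel (a b : C) : is_cokernel (0 : mor a b) (idm b).
Proof.
apply: epi_cokernel => [||x u _]; first exact: idm_epi.
- by rewrite comp1m.
- by exists u; rewrite compm1.
Qed.

(** If [i = i' t] and [i' = i j], then a left inverse [r] of [i'] gives the
    left inverse [j r] of [i], because [i (j r) i = i] and [i] is monic. *)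
Lemma section_kernel (a b k k' : C) (f : mor a b) (i : mor k a)
    (i' : mor k' a) :
  is_kernel f i -> is_kernel f i' -> is_section i' -> is_section i.
Proof.
move=> ker_i ker_i' [r ri'].
have [t i't] := kernel_factor ker_i' (proj1 ker_i).
have [j ij] := kernel_factor ker_i (proj1 ker_i').
have ri : r \oc i = t by rewrite -i't compmA ri' comp1m.
exists (j \oc r); apply: (kernel_mono ker_i).
by rewrite -compmA ri compmA ij i't compm1.
Qed.

Lemma retraction_cokernel (a b q q' : C) (f : mor a b) (p : mor b q)
    (p' : mor b q') :
  is_cokernel f p -> is_cokernel f p' -> is_retraction p' -> is_retraction p.
Proof.
move=> coker_p coker_p' [s p's].
have [t tp'] := cokernel_factor coker_p' (proj1 coker_p).
have [j jp] := cokernel_factor coker_p (proj1 coker_p').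
have ps : p \oc s = t by rewrite -tp' -compmA p's compm1.
exists (s \oc j); apply: (cokernel_epi coker_p).
by rewrite compmA ps -compmA jp tp' comp1m.
Qed.

End Preadditive.

(** * Exact sequences as kernels and cokernels *)

Section Abelian.
Variable A : abelianType.

(** The sequence makes [f] monic, hence a kernel of some [h].  Since [h] kills
    [f], it factors through the cokernel [p] of [f], so whatever is killed by
    [p] factors through [f]; and exactness at the middle says that [p] and [g]
    kill the same arrows. *)
Lemma left_exact_seqP (a b c : A) (f : mor a b) (g : mor b c) :
  left_exact_seq f g <-> is_kernel g f.
Proof.
split=> [[z [z0 [m0 [i0 [[q0 [p0 [coker_p0 ker_i0]]] ker_f]]]
            [m [i [[q [p [coker_p ker_i]]] ker_g]]]]] | ker_f].
  have f_mono : monomorphism f.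
    (* The cokernel [p0] of [0 -> a] is split monic, so its kernel [i0],
       which is also the kernel of [f], vanishes. *)
    have [s sp0] : exists s, s \oc p0 = idm a.
      by apply: (cokernel_factor coker_p0); rewrite compm0.
    have i00 : i0 = 0.
      by rewrite -(comp1m _ _ i0) -sp0 -compmA (proj1 ker_i0) compm0.
    apply: monomorphism0 => x u /(kernel_factor ker_f)[v <-].
    by rewrite i00 comp0m.
  have [d [h ker_h]] := monic_normal _ _ _ f_mono.
  apply: mono_kernel => // [|x u gu0].
    have [v <-] := kernel_factor ker_i (proj1 coker_p).
    by rewrite compmA (proj1 ker_g) comp0m.
  apply: (kernel_factor ker_h).
  have [w <-] := kernel_factor ker_g gu0.
  have [t <-] := cokernel_factor coker_p (proj1 ker_h).
  by rewrite -compmA (compmA _ _ _ _ p) (proj1 ker_i) comp0m compm0.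
have f_mono := kernel_mono ker_f.
have [z z0] := @has_zero_object A; exists z; split=> //.
  exists z, 0; split; last exact: kernel0.
  exists a, (idm a); split; first exact: idm_cokernel.
  exact: kernel0 z0 (@idm_mono _ a).
exists a, f; split=> //.
have [q [p coker_p]] := has_cokernels _ _ f.
exists q, p; split=> //; apply: mono_kernel => // [|x u pu0].
  exact: (proj1 coker_p).
have [t tp] := cokernel_factor coker_p (proj1 ker_f).
by apply: (kernel_factor ker_f); rewrite -tp -compmA pu0 compm0.
Qed.

(** Dually, [g] is epic, hence a cokernel of some [h].  As [g] and the cokernel
    [p] of [f] have the same kernel, [p] kills [h], so whatever kills [f]
    factors through [p], kills [h], and thus factors through [g]. *)
Lemma right_exact_seqP (a b c : A) (f : mor a b) (g : mor b c) :
  right_exact_seq f g <-> is_cokernel f g.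
Proof.
split=> [[z [z0 [m [i [[q [p [coker_p ker_i]]] ker_g]]]
            [m0 [i0 [[q0 [p0 [coker_p0 ker_i0]]] ker_0]]]]] | coker_g].
  have g_epi : epimorphism g.
    (* The kernel [i0] of [c -> 0] is split epic, so the cokernel [p0] of [g],
       which it composes to zero with, vanishes. *)
    have [s i0s] : exists s, i0 \oc s = idm c.
      by apply: (kernel_factor ker_0); rewrite comp0m.
    have p00 : p0 = 0.
      by rewrite -(compm1 _ _ p0) -i0s compmA (proj1 ker_i0) comp0m.
    apply: epimorphism0 => x u /(cokernel_factor coker_p0)[v <-].
    by rewrite p00 compm0.
  have [d [h coker_h]] := epic_normal _ _ _ g_epi.
  apply: epi_cokernel => // [|x u uf0].
    have [v <-] := kernel_factor ker_i (proj1 coker_p).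
    by rewrite compmA (proj1 ker_g) comp0m.
  apply: (cokernel_factor coker_h).
  have [w <-] := cokernel_factor coker_p uf0.
  have [t <-] := kernel_factor ker_g (proj1 coker_h).
  by rewrite -compmA (compmA _ _ _ _ p) (proj1 ker_i) comp0m compm0.
have g_epi := cokernel_epi coker_g.
have [z z0] := @has_zero_object A; exists z; split=> //.
  have [k [i ker_i]] := has_kernels _ _ g.
  by exists k, i; split=> //; exists c, g.
exists c, (idm c); split; last exact: idm_kernel.
exists z, 0; split; [exact: cokernel0 | exact: idm_kernel].
Qed.

End Abelian.

Lemma fmap_kernel (A B : abelianType) (F : functor A B) (a b k : A)
    (f : mor a b) (i : mor k a) :
  left_exact F -> is_kernel f i -> is_kernel (fmap F f) (fmap F i).
Proof. by move=> F_lex /left_exact_seqP/F_lex/left_exact_seqP. Qed.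

Lemma fmap_cokernel (A B : abelianType) (F : functor A B) (a b q : A)
    (f : mor a b) (p : mor b q) :
  right_exact F -> is_cokernel f p -> is_cokernel (fmap F f) (fmap F p).
Proof. by move=> F_rex /right_exact_seqP/F_rex/right_exact_seqP. Qed.

(** * Fully faithful functors and split morphisms *)

Lemma section_fmapP (C D : categoryType) (F : functor C D) (a b : C)
    (f : mor a b) :
  fully_faithful F -> is_section (fmap F f) <-> is_section f.
Proof.
case=> F_full F_faith; split=> [[r' r'f] | [r rf]]; last first.
  by exists (fmap F r); rewrite -fmap_comp rf fmap1.
have [r Fr] := F_full _ _ r'; exists r; apply: F_faith.
by rewrite fmap_comp Fr r'f fmap1.
Qed.

Lemma retraction_fmapP (C D : categoryType) (F : functor C D) (a b : C)
    (f : mor a b) :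
  fully_faithful F -> is_retraction (fmap F f) <-> is_retraction f.
Proof.
case=> F_full F_faith; split=> [[s' fs'] | [s fs]]; last first.
  by exists (fmap F s); rewrite -fmap_comp fs fmap1.
have [s Fs] := F_full _ _ s'; exists s; apply: F_faith.
by rewrite fmap_comp Fs fs' fmap1.
Qed.

(** * Rickart objects under fully faithful functors *)

Theorem theorem2p3 (A B : abelianType) (F : functor A B) (M N : A) :
  fully_faithful F ->
  (left_exact F -> (Rickart M N <-> Rickart (F M) (F N))) /\
  (right_exact F -> (dual_Rickart M N <-> dual_Rickart (F M) (F N))).
Proof.
move=> F_ff; have [F_full _] := F_ff.
split=> F_ex; split=> [ricMN g | ricFMN f].
- have [f <-] := F_full _ _ g => K k ker_k.
  have [K0 [k0 ker_k0]] := has_kernels _ _ f.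
  apply: (section_kernel ker_k (fmap_kernel F_ex ker_k0)).
  by apply/section_fmapP => //; apply: ricMN ker_k0.
- move=> K k ker_k; apply/(section_fmapP _ F_ff).
  exact: ricFMN (fmap_kernel F_ex ker_k).
- have [f <-] := F_full _ _ g => Q q coker_q.
  have [Q0 [q0 coker_q0]] := has_cokernels _ _ f.
  apply: (retraction_cokernel coker_q (fmap_cokernel F_ex coker_q0)).
  by apply/retraction_fmapP => //; apply: ricMN coker_q0.
- move=> Q q coker_q; apply/(retraction_fmapP _ F_ff).
  exact: ricFMN (fmap_cokernel F_ex coker_q).
Qed.
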